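(* Let $d, N, M \ge 1$ be integers, $\sigma \ge 0$, and let $\Lambda \in \mathbb{R}^{d\times d}$ be symmetric positive semidefinite with eigendecomposition $\Lambda = QDQ^\top$, $Q$ orthonormal, $D = \mathrm{diag}([\lambda_1,\dots,\lambda_d])$, $\lambda_1\ge\dots\ge\lambda_d\ge 0$. For $k\in\{0,\dots,d\}$ let $V^{(k)} = \mathrm{diag}([v^{(k)}_1,\dots,v^{(k)}_d])$ with $v^{(k)}_i = \frac{N}{(N+1)\lambda_i + \mathrm{tr}(D)}$ for $i\le k$ and $v^{(k)}_i=0$ for $i>k$, and let $f^{(k)}$ be the model $$f^{(k)}(E) = \left[E + W^{PV}_k E\cdot\frac{E^\top W^{KQ}_k E}{M}\right]_{(d+1),(M+1)},\quad W^{PV}_k = \begin{pmatrix}0_{d\times d} & 0_d\\ 0_d^\top & 1/c_k\end{pmatrix},\quad W^{KQ}_k = \begin{pmatrix} c_k QV^{(k)}Q^\top & 0_d\\ 0_d^\top & 0\end{pmatrix}$$ for some nonzero constant $c_k$ (the optimal rank-$k$ solution). Let $0 \le r \le r' \le d$, $f_1 = f^{(r)}$, $f_2 = f^{(r')}$, and let $w = Qs$ where $s \in \mathbb{R}^d$ satisfies $s_i = 0$ for all $r < i \le d$. Let $x_1,\dots,x_M,x_q \overset{\text{i.i.d.}}{\sim}\mathcal{N}(0,\Lambda)$, independently $\epsilon_1,\dots,\epsilon_M\overset{\text{i.i.d.}}{\sim}\mathcal N(0,\sigma^2)$, and $$\widehat{E} = \begin{pmatrix} x_1 & \cdots & x_M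 & x_q \\ \langle w,x_1\rangle + \epsilon_1 & \cdots & \langle w,x_M\rangle + \epsilon_M & 0\end{pmatrix},$$ and define $\mathcal{L}(f;\widehat E) := \mathbb{E}_{x_1,\epsilon_1,\dots,x_M,\epsilon_M,x_q}\left(f(\widehat E) - \langle w,x_q\rangle\right)^2$. Then $$\mathcal{L}(f_2;\widehat E) - \mathcal{L}(f_1;\widehat E) = \frac1M\left(\|s\|_D^2 + \sigma^2\right)\sum_{i=r+1}^{r'}\left(\frac{N\lambda_i}{(N+1)\lambda_i + \mathrm{tr}(D)}\right)^2.$$
   Context: For a positive semidefinite matrix $A$, $\|x\|_A^2 := x^\top A x$. The model $f^{(k)}$ is the optimal rank-$k$ one-layer linear self-attention solution for in-context linear regression with $N$ pretraining examples per prompt (pretraining tokens from $\mathcal N(0,\Lambda)$, task weights from $\mathcal N(0,I_d)$); at evaluation the normalization factor equals $M$. *)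

(* Defs.v *)
From HB Require Import structures.
From mathcomp Require Import all_boot all_order all_algebra.
From mathcomp Require Import all_classical all_reals all_analysis.
Set Implicit Arguments. Unset Strict Implicit. Unset Printing Implicit Defensive.
Import Order.TTheory GRing.Theory Num.Theory.
Local Open Scope classical_set_scope.
Local Open Scope ring_scope.

Section Defs.
Context {R : realType}.

Definition std_normal_rv {dT : measure_display} {T : measurableType dT}
  (P : probability T R) (X : T -> R) : Prop :=
  measurable_fun setT X /\
  forall B : set R, measurable B -> P (X @^-1` B) = normal_prob (0:R) 1 B.

(** Mutual independence of a finite family of real random variables:
    product rule for every family of Borel sets (taking B i = setT
    recovers every subfamily). *)
Definition mutually_independent {dT : measure_display} {T : measurableType dT}
  (P : probability T R) (I : finType) (X : I -> T -> R) : Prop :=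
  forall B : I -> set R, (forall i, measurable (B i)) ->
    P (\bigcap_(i in [set: I]) (X i @^-1` B i)) =
    (\prod_(i : I) P (X i @^-1` B i))%E.

(** The diagonal of V^(k) (0-based index i; i < k means 1-based i <= k). *)
Definition vk (d Nn k : nat) (lam : 'I_d -> R) (i : 'I_d) : R :=
  if (i < k)%N then Nn%:R / ((Nn.+1)%:R * lam i + \sum_(j < d) lam j) else 0.

Definition Vk (d Nn k : nat) (lam : 'I_d -> R) : 'M[R]_d :=
  diag_mx (\row_i vk Nn k lam i).

Definition WPV (d : nat) (c : R) : 'M[R]_(d + 1) :=
  block_mx (0 : 'M[R]_(d, d)) (0 : 'M[R]_(d, 1)) (0 : 'M[R]_(1, d)) (c^-1)%:M.

Definition WKQ (d Nn k : nat) (lam : 'I_d -> R) (Q : 'M[R]_d) (c : R)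
  : 'M[R]_(d + 1) :=
  block_mx (c *: (Q *m Vk Nn k lam *m Q^T)) (0 : 'M[R]_(d, 1))
           (0 : 'M[R]_(1, d)) (0 : 'M[R]_(1, 1)).

Definition fk (d Nn M k : nat) (lam : 'I_d -> R) (Q : 'M[R]_d) (c : R)
  (E : 'M[R]_(d + 1, M + 1)) : R :=
  (E + WPV d c *m E *m ((M%:R)^-1 *: (E^T *m WKQ Nn k lam Q c *m E)))
    (rshift d (ord0 : 'I_1)) (rshift M (ord0 : 'I_1)).

(** Index set of the underlying i.i.d. standard normal variables:
    (j, i) : coordinates of the standard Gaussian vectors z_j (j < M),
    i : coordinates of z_q, j : the noises e_j. *)
Definition noise_idx (d M : nat) : finType :=
  (('I_M * 'I_d) + 'I_d + 'I_M)%type.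

(** The prompt matrix Ehat at sample point t: x_j = A z_j, x_q = A z_q
    (with A A^T = Lambda, so x_j ~ Nn(0, Lambda)), eps_j = sigma e_j. *)
Definition xj {dT} {T : measurableType dT} (d M : nat) (A : 'M[R]_d)
  (Z : noise_idx d M -> T -> R) (j : 'I_M) (t : T) : 'cV[R]_d :=
  A *m \col_i Z (inl (inl (j, i))) t.

Definition xq {dT} {T : measurableType dT} (d M : nat) (A : 'M[R]_d)
  (Z : noise_idx d M -> T -> R) (t : T) : 'cV[R]_d :=
  A *m \col_i Z (inl (inr i)) t.

Definition eps {dT} {T : measurableType dT} (d M : nat) (sigma : R)
  (Z : noise_idx d M -> T -> R) (j : 'I_M) (t : T) : R :=
  sigma * Z (inr j) t.

Definition dotv (d : nat) (u v : 'cV[R]_d) : R := (u^T *m v) 0 0.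

Definition Ehat {dT} {T : measurableType dT} (d M : nat) (A : 'M[R]_d)
  (sigma : R) (w : 'cV[R]_d) (Z : noise_idx d M -> T -> R) (t : T)
  : 'M[R]_(d + 1, M + 1) :=
  block_mx (\matrix_(i < d, j < M) xj A Z j t i 0) (xq A Z t)
           (\row_(j < M) (dotv w (xj A Z j t) + eps sigma Z j t))
           (0 : 'M[R]_(1, 1)).

Definition loss {dT} {T : measurableType dT} (P : probability T R) (d M : nat)
  (f : 'M[R]_(d + 1, M + 1) -> R) (A : 'M[R]_d) (sigma : R)
  (w : 'cV[R]_d) (Z : noise_idx d M -> T -> R) : \bar R :=
  (\int[P]_(t in [set: T]) ((f (Ehat A sigma w Z t) - dotv w (xq A Z t)) ^+ 2)%:E)%E.

End Defs.

(* Main.v *)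
(* The last entry of [f^(k)(E)] is [sum_i v^(k)_i xq_i h_i] in the eigenbasis
   [x |-> Q^T x], with [h_i = (1/M) sum_j y_j x_(j,i)].  The query coordinates
   [xq_i] are uncorrelated with variances [lambda_i] and independent of the
   prompt, so the loss is [sum_i lambda_i E(v^(k)_i h_i - s_i)^2].  The terms of
   the two losses differ only for [r <= i < r'], where [s_i = 0] and
   [v^(r)_i = 0], which leaves [lambda_i v_i^2 E h_i^2].  There [y_j] and
   [x_(j,i)] are uncorrelated linear forms of a standard Gaussian family, and
   Wick's formula for four linear forms gives
   [E h_i^2 = (|s|_D^2 + sigma^2) lambda_i / M].  Wick's formula comes down to
   the moments of the standard normal law up to order 4 and the product formula
   for expectations under independence. *)
Require Import Defs.
From HB Require Import structures.
From mathcomp Require Import all_boot all_order all_algebra.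
From mathcomp Require Import all_classical all_reals all_analysis.
From mathcomp Require Import measurable_realfun.
From mathcomp Require Import ring lra zify.
Import Order.TTheory GRing.Theory Num.Theory.
Import numFieldNormedType.Exports.
Local Open Scope classical_set_scope.
Local Open Scope ring_scope.

(** * Extension of integral identities from indicators to nonnegative functions *)

Section transfer.
Import HBNNSimple.
Local Open Scope ereal_scope.
Context {R : realType} {d d' : measure_display} {X : measurableType d}
  {Y : measurableType d'}.

(* With [phi = id] this integrates against a density; with [phi] a random
   variable and [G] a function of the others it is the induction step of the
   product formula for independent variables. *)
Lemma ge0_integral_weighted (mu : {measure set X -> \bar R})
    (nu : {measure set Y -> \bar R}) (phi : Y -> X) (G : Y -> R) (K : R) :
  measurable_fun [set: Y] phi -> measurable_fun [set: Y] G ->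
  (forall y, (0 <= G y)%R) -> (0 <= K)%R ->
  (forall B, measurable B ->
     \int[nu]_y (\1_B (phi y) * G y)%:E = K%:E * mu B) ->
  forall f : X -> R, measurable_fun [set: X] f -> (forall x, (0 <= f x)%R) ->
    \int[nu]_y (f (phi y) * G y)%:E = K%:E * \int[mu]_x (f x)%:E.
Proof.
move=> mphi mG G0 K0 H f mf f0.
have mEf : measurable_fun [set: X] (fun x => (f x)%:E).
  exact/measurable_EFinP.
pose f_ := nnsfun_approx measurableT mEf.
have f_cvg x : (f_ n x)%:E @[n --> \oo] --> (f x)%:E.
  by apply: (cvg_nnsfun_approx measurableT mEf) => // y _; rewrite lee_fin.
have f_nd x m n : (m <= n)%N -> (f_ m x <= f_ n x)%R.
  by move=> mn; exact/lefP/nd_nnsfun_approx.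
have mI n r :
    measurable_fun [set: Y] (fun y => \1_(f_ n @^-1` [set r]) (phi y) : R).
  by apply: measurableT_comp mphi; exact: measurable_indic.
(* A simple function is a finite combination of indicators of its level sets, so linearity reduces
   this case to [H]. *)
have simpleE n :
    \int[nu]_y (f_ n (phi y) * G y)%:E = K%:E * \int[mu]_x (f_ n x)%:E.
  transitivity (\sum_(r \in range (f_ n))
      \int[nu]_y (r * \1_(f_ n @^-1` [set r]) (phi y) * G y)%:E).
    rewrite -ge0_integral_fsum//.
    - apply: eq_integral => y _.
      rewrite [in LHS](fimfunE (f_ n)) mulrC.
      rewrite fsumEFin// fsbig_finite//= fsbig_finite//= mulr_sumr.
      by congr EFin; apply: eq_bigr => r _; rewrite mulrC.
    - move=> r; apply/measurable_EFinP; apply: measurable_funM => //.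
      exact: measurable_funM.
    - move=> r y _.
      rewrite EFinM; apply: mule_ge0; last by rewrite lee_fin.
      by rewrite EFinM nnfun_muleindic_ge0.
  under [X in K%:E * X]eq_integral do rewrite fimfunE -fsumEFin//.
  rewrite ge0_integral_fsum//; last 2 first.
  - by move=> r; exact/measurable_EFinP/measurable_funM.
  - by move=> r x _; rewrite nnfun_muleindic_ge0.
  rewrite ge0_mule_fsumr; last first.
    by move=> r; apply: integral_ge0 => x _; rewrite nnfun_muleindic_ge0.
  apply: eq_fsbigr => r /[!inE] -[x _ rx].
  have r0 : (0 <= r)%R by rewrite -rx.
  under eq_integral do rewrite -mulrA EFinM.
  rewrite ge0_integralZl//; last 2 first.
    by apply/measurable_EFinP; exact: measurable_funM.
    by move=> y _; rewrite lee_fin mulr_ge0.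
  rewrite H// [in RHS]integralZl_indic_nnsfun// integral_indic// setIT.
  by rewrite muleCA.
(* Since [G] is nonnegative, the weighted approximations are still increasing, and monotone
   convergence applies under [nu] as well as under [mu]. *)
transitivity (limn (fun n => \int[nu]_y (f_ n (phi y) * G y)%:E)).
  rewrite -monotone_convergence//.
  - apply: eq_integral => y _; apply/esym/cvg_lim => //.
    under eq_fun do rewrite EFinM.
    by rewrite EFinM; apply: cvgeZr => //; exact: f_cvg.
  - move=> n; apply/measurable_EFinP; apply: measurable_funM => //.
    exact: measurableT_comp mphi.
  - by move=> n y _; rewrite lee_fin mulr_ge0.
  - by move=> y _ m n mn; rewrite lee_fin ler_wpM2r// f_nd.
under eq_fun do rewrite simpleE.
apply/cvg_lim => //; apply: cvgeZl => //.
rewrite [X in _ --> X](_ : _ = \int[mu]_x limn (fun n => (f_ n x)%:E)).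
  apply: cvg_monotone_convergence => //.
  - by move=> n; exact/measurable_EFinP.
  - by move=> n x _; rewrite lee_fin.
  - by move=> x _ m n mn; rewrite lee_fin f_nd.
by apply: eq_integral => x _; apply/esym/cvg_lim.
Qed.
End transfer.

(** * Moments of the standard normal law *)

Section gaussian_moments.
Context {R : realType}.
Local Notation mu := (@lebesgue_measure R).
Local Notation phi := (normal_pdf (0 : R) 1).
Local Notation gauss := (normal_prob (0 : R) 1).

Lemma ge0_integral_normal_prob (f : R -> R) :
  measurable_fun [set: R] f -> (forall x, 0 <= f x) ->
  (\int[gauss]_x (f x)%:E = \int[mu]_x (f x * phi x)%:E)%E.
Proof.
move=> mf f0; rewrite -[LHS]mul1e; apply/esym.
apply: (@ge0_integral_weighted _ _ _ _ _ gauss mu id phi 1) => //.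
- exact: measurable_normal_pdf.
- exact: normal_pdf_ge0.
- move=> B mB; rewrite mul1e /normal_prob [RHS]integral_mkcond.
  apply: eq_integral => x _; rewrite /= patchE indicE.
  by case: (x \in B); rewrite (mul1r, mul0r).
Qed.

Lemma std_normal_pdfE x : phi x = normal_peak 1 * expR (- x ^+ 2 / 2).
Proof.
by rewrite normal_pdfE ?oner_neq0// /normal_fun subr0 expr1n.
Qed.

(** This makes [x * phi x] the derivative of [- phi], which is what drives the recursion on moments
    by parts. *)
Lemma is_derive_std_normal_pdf (x : R) : is_derive x 1 phi (- x * phi x).
Proof.
have -> : phi = normal_peak 1 \*: (expR \o ((- 2^-1) \*: (id ^+ 2))).
  apply/funext => y; rewrite std_normal_pdfE/= /GRing.scale/=.
  by congr (_ * expR _); rewrite !mulNr mulrC.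
apply: is_derive_eq.
rewrite !fctE /= /GRing.scale/= !mulr1 expr1.
by field.
Qed.

Lemma pow_normal_pdf_bounded (k : nat) :
  exists c, forall x : R, 0 <= x -> x ^+ k * phi x <= c.
Proof.
(* The constant comes from [1 + y ^ k.+1 / k.+1! <= expR y] at [y = x ^ 2 / 2], multiplied by
   [2 ^ k.+1 * k.+1!] to clear denominators. *)
exists (normal_peak 1 * (2 ^+ k.+1 * (k.+1)`!%:R)) => x x0.
rewrite std_normal_pdfE mulrCA ler_wpM2l ?normal_peak_ge0//.
have y0 : 0 <= x ^+ 2 / 2 by rewrite divr_ge0 ?sqr_ge0.
rewrite mulNr expRN ler_pdivrMr ?expR_gt0//.
have := expR_ge1Dxn k y0.
rewrite -(ler_pM2l (x := 2 ^+ k.+1 * k.+1`!%:R)); last first.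
  by rewrite mulr_gt0 ?exprn_gt0// ltr0n fact_gt0.
apply: le_trans.
rewrite exprMn exprVn mulrDr mulr1 -[leLHS]add0r.
rewrite [X in _ <= _ + X](_ : _ = x ^+ 2 ^+ k.+1); last first.
  by field; rewrite pnatr_eq0 -lt0n fact_gt0 expf_neq0.
(* For [x <= 1] the constant term dominates [x ^ k]; for [x > 1] the term [x ^ (2 * k.+1)] does. *)
rewrite -exprM; have [x1|x1] := leP x 1.
  rewrite addrC lerD ?exprn_ge0// (le_trans (exprn_ile1 _ _ _))//.
  by rewrite -natrX -natrM ler1n muln_gt0 expn_gt0 fact_gt0.
rewrite lerD ?mulr_ge0 ?exprn_ge0// ler_weXn2l ?(ltW x1)//.
by lia.
Qed.

(** The bound for one more power, [n ^ k.+1 * phi n <= c], gives decay at rate [c / n]. *)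
Lemma cvg_pow_normal_pdf k : (n%:R ^+ k * phi n%:R : R) @[n --> \oo] --> (0 : R).
Proof.
have [c Hc] := pow_normal_pdf_bounded k.+1.
have c0 : 0 <= c by apply: le_trans (Hc 0 _); rewrite ?expr0n ?mul0r.
apply/cvgrPdist_le => e e0; near=> n.
have n0 : (0 < n%:R :> R) by rewrite ltr0n; near: n; exact: nbhs_infty_gt.
rewrite sub0r normrN ger0_norm ?mulr_ge0 ?exprn_ge0 ?normal_pdf_ge0//.
rewrite -(ler_pM2l n0) mulrA -exprS (le_trans (Hc _ (ltW n0)))//.
rewrite mulrC -ler_pdivrMl//.
near: n; exact: nbhs_infty_ger.
Unshelve. all: by end_near. Qed.

(** Integration by parts with [x ^ n.+1] differentiated and [x * phi x] integrated to [- phi x]; the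
    subtracted term is the boundary contribution. *)
Lemma gauss_by_parts_itv (n : nat) (a : R) : 0 < a ->
  (\int[mu]_(x in `[(- a)%R, a]) (x ^+ n.+2 * phi x)%:E =
   n.+1%:R%:E * \int[mu]_(x in `[(- a)%R, a]) (x ^+ n * phi x)%:E
    - (a ^+ n.+1 * phi a - (- a) ^+ n.+1 * phi a)%:E)%E.
Proof.
move=> a0.
have phiN : phi (- a) = phi a by rewrite !std_normal_pdfE sqrrN.
have cphi : continuous phi by apply: continuous_normal_pdf; exact: oner_neq0.
have cpow k : continuous (fun x : R => x ^+ k) by move=> x; exact: exprn_continuous.
have ltNa : - a < a by rewrite gtrN.
have dNphi (x : R) : is_derive x (1 : R) (fun x : R => - phi x) (x * phi x).
  rewrite -[x * _]opprK -mulNr; apply: is_deriveN; exact: is_derive_std_normal_pdf.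
have dpow (x : R) : is_derive x (1 : R) (fun x : R => x ^+ n.+1) (n.+1%:R * x ^+ n).
  have -> : (fun x : R => x ^+ n.+1) = id ^+ n.+1.
    by apply/funext => y; rewrite exprfctE.
  by apply: is_derive_eq; rewrite /GRing.scale/= mulr1.
have cF : continuous (fun x : R => - phi x).
  by move=> x; apply: cvgN; exact: cphi.
have LR (F : R -> R) (f : R -> R) : continuous F ->
    (forall x : R, is_derive x (1 : R) F (f x)) ->
    derivable_oo_LRcontinuous F (- a) a /\ {in `](- a), a[, derive1 F =1 f}.
  move=> CF dF; split; first split.
  - by move=> x _; have [] := dF x.
  - exact/cvg_at_right_filter/CF.
  - exact/cvg_at_left_filter/CF.
  - by move=> x _; rewrite derive1E; have [] := dF x.
have [LR1 D1] := LR _ _ (cpow n.+1) dpow.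
have [LR2 D2] := LR _ _ cF dNphi.
under eq_integral do rewrite exprSr -mulrA.
rewrite (@integration_by_parts R (fun x => x ^+ n.+1) (fun x => - phi x)
  (fun x => n.+1%:R * x ^+ n) (fun x => x * phi x) (- a) a ltNa)//; last 2 first.
- by apply: continuous_subspaceT => x; apply: cvgM; [exact: cvg_cst|exact: cpow].
- by apply: continuous_subspaceT => x; apply: cvgM; [exact: cvg_id|exact: cphi].
have int_pow : mu.-integrable `[(- a)%R, a] (EFin \o (fun x => x ^+ n * phi x)).
  apply: continuous_compact_integrable; first exact: segment_compact.
  by apply: continuous_subspaceT => x; apply: cvgM; [exact: cpow|exact: cphi].
rewrite [X in (_ - X)%E](_ : _ = (- n.+1%:R)%:E *
    \int[mu]_(x in `[(- a)%R, a]) (x ^+ n * phi x)%:E)%E; last first.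
  rewrite -integralZl//; apply: eq_integral => x _.
  by rewrite -EFinM mulrN mulNr mulrA.
rewrite phiN EFinN mulNe oppeK addeC; congr (_ + _)%E.
by rewrite -EFinN; congr EFin; ring.
Qed.

(* Integrate by parts on [-i, i] and let [i] tend to infinity. *)
Lemma gauss_even_moment_rec (k : nat) (c : R) :
  (\int[mu]_x (x ^+ k.*2 * phi x)%:E = c%:E)%E ->
  (\int[mu]_x (x ^+ k.*2.+2 * phi x)%:E = (k.*2.+1%:R * c)%:E)%E.
Proof.
move=> Ik.
pose F (i : nat) : set R := `[(- i%:R)%R, i%:R]%classic.
have FT : \bigcup_i F i = [set: R].
  apply/seteqP; split => // x _; exists (Num.truncn `|x|).+1 => //=.
  by rewrite /F/= in_itv/= -ler_norml ltW// truncnS_gt.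
have ndF : nondecreasing_seq F.
  move=> m n mn; apply/subsetPset => x; rewrite /F/= !in_itv/=.
  by rewrite -!ler_norml => /le_trans; apply; rewrite ler_nat.
have cvgS j : (\int[mu]_(x in F i) (x ^+ j.*2 * phi x)%:E @[i --> \oo] -->
    \int[mu]_x (x ^+ j.*2 * phi x)%:E)%E.
  rewrite -FT; apply: ge0_nondecreasing_set_cvg_integral => //.
  - by move=> i; exact: measurable_itv.
  - move=> i; apply/measurable_EFinP/measurable_funTS/measurable_funM.
      exact: measurable_funX.
    exact: measurable_normal_pdf.
  - move=> i x _; rewrite lee_fin mulr_ge0 ?normal_pdf_ge0//.
    by rewrite exprn_even_ge0// odd_double.
have := cvgS k.+1; rewrite doubleS => /cvg_unique; apply => //.
(* The exponent [k.*2.+1] is odd, so the boundary terms at [i] and [- i] add up to twice one of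
   them, and this tends to 0. *)
have : (k.*2.+1%:R%:E * (\int[mu]_(x in F i) (x ^+ k.*2 * phi x)%:E) -
   (2 * (i%:R ^+ k.*2.+1 * phi i%:R))%:E @[i --> \oo] -->
   k.*2.+1%:R%:E * c%:E - (2 * 0)%:E)%E.
  apply: cvgeB => //.
    by apply: cvgeZl => //; rewrite -Ik; exact: cvgS.
  apply: cvg_EFin; first exact: nearW.
  by apply: cvgMr; exact: cvg_pow_normal_pdf.
rewrite mulr0 sube0 -EFinM; apply: cvg_trans; apply: near_eq_cvg.
near=> i; rewrite gauss_by_parts_itv; last first.
  by rewrite ltr0n; near: i; exact: nbhs_infty_gt.
congr (_ - _%:E)%E; rewrite [(- _) ^+ _]exprNn -signr_odd /= odd_double /= expr1.
by ring.
Unshelve. all: by end_near. Qed.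

Lemma gauss_even_moment (k : nat) :
  exists c : R, (\int[mu]_x (x ^+ k.*2 * phi x)%:E = c%:E)%E.
Proof.
elim: k => [|k [c IHc]]; last first.
  by exists (k.*2.+1%:R * c); rewrite doubleS; exact: gauss_even_moment_rec.
exists 1; rewrite -(integral_normal_pdf (0 : R) 1).
by apply: eq_integral => x _; rewrite expr0 mul1r.
Qed.

Definition gauss_moment (n : nat) : R := \int[gauss]_x (x ^+ n).

(** Even powers are nonnegative with a finite integral; any other power is dominated through
    [y <= 1 + y ^ 2] with [y = |x ^ n|]. *)
Lemma integrable_gauss_pow n :
  gauss.-integrable [set: R] (EFin \o (fun x : R => x ^+ n)).
Proof.
have int_even k : gauss.-integrable [set: R] (EFin \o (fun x : R => x ^+ k.*2)).
  apply/integrableP; split; first exact/measurable_EFinP.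
  have x0 (x : R) : 0 <= x ^+ k.*2 by rewrite exprn_even_ge0// odd_double.
  under eq_integral do rewrite /= ger0_norm//.
  rewrite ge0_integral_normal_prob//.
  by have [c ->] := gauss_even_moment k; exact: ltry.
have := integrableD measurableT (int_even 0) (int_even n).
apply: le_integrable => //; first exact/measurable_EFinP.
move=> x _ /=; rewrite lee_fin expr0 -muln2 exprM.
rewrite [leRHS]ger0_norm ?addr_ge0 ?sqr_ge0// -(real_normK (num_real (x ^+ n))).
set y := `|x ^+ n|.
suff : 0 <= (y - 1 / 2) ^+ 2 by lra.
exact: sqr_ge0.
Qed.

Lemma gauss_moment0 : gauss_moment 0 = 1.
Proof.
rewrite /gauss_moment /Rintegral; under eq_integral do rewrite expr0.
rewrite integral_cst// mul1e; transitivity (fine (1%E : \bar R)) => //.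
by congr fine; exact: integral_normal_pdf.
Qed.

Lemma gauss_moment_even_rec k :
  gauss_moment k.*2.+2 = k.*2.+1%:R * gauss_moment k.*2.
Proof.
have E j : (\int[gauss]_x (x ^+ j.*2)%:E = \int[mu]_x (x ^+ j.*2 * phi x)%:E)%E.
  apply: ge0_integral_normal_prob => //.
  by move=> x; rewrite exprn_even_ge0// odd_double.
have [c Hc] := gauss_even_moment k.
rewrite /gauss_moment /Rintegral -doubleS !E Hc doubleS.
by rewrite (gauss_even_moment_rec _ _ Hc).
Qed.

Lemma ge0_integralT_oppr (f : R -> \bar R) :
  measurable_fun [set: R] f -> (forall x, 0 <= f x)%E ->
  (\int[mu]_x f (- x)%R = \int[mu]_x f x)%E.
Proof.
move=> mf f0; apply/esym.
transitivity (\int[pushforward mu (-%R : _ -> measurableTypeR R)]_x f x)%E.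
  by apply: eq_measure_integral => //= B mB _; exact/esym/lebesgue_measureN.
by rewrite ge0_integral_pushforward//= => x _; exact: f0.
Qed.

Lemma normal_prob_oppr (B : set R) : measurable B ->
  gauss ((-%R : R -> R) @^-1` B) = gauss B.
Proof.
move=> mB; rewrite /normal_prob integral_mkcond [RHS]integral_mkcond.
rewrite -[RHS]ge0_integralT_oppr.
- apply: eq_integral => x _; rewrite !patchE !std_normal_pdfE sqrrN.
  have -> // : (x \in -%R @^-1` B) = (- x \in B).
    by apply/idP/idP => /set_mem xB; apply/mem_set.
- apply/(measurable_restrictT _ _).1 => //.
  by apply/measurable_funTS/measurable_EFinP; exact: measurable_normal_pdf.
- by move=> x; rewrite patchE; case: ifP => // _; rewrite lee_fin normal_pdf_ge0.
Qed.

(** The reflection [x |-> - x] preserves the law and changes the sign of an odd power, so the moment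
    equals its own opposite. *)
Lemma gauss_moment_odd n : odd n -> gauss_moment n = 0.
Proof.
move=> oddn.
suff : gauss_moment n = - gauss_moment n by lra.
rewrite -[RHS]mulN1r -RintegralZl//; last exact: integrable_gauss_pow.
transitivity (fine (\int[pushforward gauss
    (-%R : _ -> measurableTypeR R)]_x (x ^+ n)%:E)%E).
  congr fine; apply: eq_measure_integral => //= B mB _.
  exact/esym/normal_prob_oppr.
rewrite integral_pushforward//.
  congr fine; apply: eq_integral => x _ /=; rewrite exprNn -signr_odd oddn.
  by rewrite expr1.
  exact/measurable_EFinP.
rewrite preimage_setT.
have := integrableZl measurableT (-1)%R (integrable_gauss_pow n).
apply: eq_integrable => // x _ /=.
by rewrite -EFinM exprNn -signr_odd oddn expr1.
Qed.

End gaussian_moments.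

(** * Product formula for independent normal variables *)

Section independence.
Context {R : realType} {dT : measure_display} {T : measurableType dT}
  (P : probability T R) {I : finType} (Z : I -> T -> R).
Hypothesis Znorm : forall a, std_normal_rv P (Z a).
Hypothesis Zind : mutually_independent P Z.
Local Notation gauss := (normal_prob (0 : R) 1).

Let mZ a : measurable_fun [set: T] (Z a). Proof. by have [] := Znorm a. Qed.

Lemma measurable_prod_family (g : I -> R -> R) (A : pred I) :
  (forall a, measurable_fun [set: R] (g a)) ->
  measurable_fun [set: T] (fun t => \prod_(a | A a) g a (Z a t)).
Proof.
move=> mg; under eq_fun do rewrite -big_filter.
apply: measurable_prod => a _.
exact: measurableT_comp (mg a) (mZ a).
Qed.

Let int_meas (f : R -> R) : gauss.-integrable [set: R] (EFin \o f) ->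
  measurable_fun [set: R] f.
Proof. by move=> /measurable_int /measurable_EFinP. Qed.

Let gauss_int_indic (B : set R) : measurable B ->
  gauss.-integrable [set: R] (EFin \o \1_B).
Proof. by move=> mB; apply: integrable_indic => //; exact: fin_num_measure. Qed.

Lemma Rintegral_gauss_indic (B : set R) : measurable B ->
  ((\int[gauss]_x \1_B x)%:E = gauss B)%E.
Proof.
move=> mB; rewrite /Rintegral integral_indic// setIT fineK//.
exact: fin_num_measure.
Qed.

(** Both inductions below modify a family at a single index; [upd] keeps the result a family over
    all of [I], to which the induction hypothesis applies. *)
Definition upd (g : I -> R -> R) a f := fun b => if b == a then f else g b.

Lemma updD1 g a f (t : T) : \prod_b upd g a f b (Z b t) =
  f (Z a t) * \prod_(b | b != a) g b (Z b t).
Proof.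
rewrite (bigD1 a)//= /upd eqxx; congr (_ * _).
by apply: eq_bigr => b /negPf ->.
Qed.

Lemma updE g a : upd g a (g a) = g.
Proof. by apply/funext => b; rewrite /upd; case: eqP => [->|]. Qed.

Lemma prod_upd (phi : (R -> R) -> R) g a f :
  \prod_b phi (upd g a f b) = phi f * \prod_(b | b != a) phi (g b).
Proof.
rewrite (bigD1 a)//= /upd eqxx; congr (_ * _).
by apply: eq_bigr => b /negPf ->.
Qed.

Lemma upd_ind (Q : (R -> R) -> Prop) g a f :
  (forall b, Q (g b)) -> Q f -> forall b, Q (upd g a f b).
Proof. by move=> Qg Qf b; rewrite /upd; case: ifP. Qed.

(* Induction on the set of indices whose factor is not an indicator: each step
   upgrades one factor from indicators to nonnegative functions. *)
Lemma indep_ge0_seq (s : seq I) (g : I -> R -> R) :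
  (forall a, gauss.-integrable [set: R] (EFin \o g a)) ->
  (forall a x, 0 <= g a x) ->
  (forall a, a \notin s -> exists2 B, measurable B & g a = \1_B) ->
  (\int[P]_t (\prod_a g a (Z a t))%:E = (\prod_a \int[gauss]_x g a x)%:E)%E.
Proof.
elim: s g => [|a s IH] g ig g0 gs.
  (* When every factor is an indicator, the product is the indicator of the intersection of the
     preimages, and the formula is [Zind] itself. *)
  have /choice [B HB] : forall a, exists B, measurable B /\ g a = \1_B.
    by move=> a; have [//|B mB ->] := gs a; exists B.
  have mB a : measurable (B a) by have [] := HB a.
  have -> : (\prod_a \int[gauss]_x g a x)%:E = (\prod_a P (Z a @^-1` B a))%E.
    rewrite -prodEFin; apply: eq_bigr => a _.
    have [_ ->] := HB a; rewrite Rintegral_gauss_indic//.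
    by have [_ ->] := Znorm a.
  rewrite -Zind//.
  have mI : measurable (\bigcap_(a in [set: I]) (Z a @^-1` B a)).
    apply: fin_bigcap_measurable; first exact: finite_finset.
    by move=> a _; rewrite -[X in measurable X]setTI; exact: mZ.
  rewrite -[in RHS](setIT (bigcap _ _)) -integral_indic//.
  apply: eq_integral => t _; congr EFin; rewrite indicE.
  case: (boolP (t \in _)) => [/set_mem tI|tI].
    rewrite big1// => a _; have [_ ->] := HB a.
    by rewrite indicE mem_set//; exact: tI.
  have [a ta] : exists a, ~ B a (Z a t).
    apply/existsNP => Ht; move/negP : tI; apply.
    by apply/mem_set => a _; exact: Ht.
  rewrite (bigD1 a)//=; have [_ ->] := HB a.
  by rewrite indicE memNset// mul0r.
have G0 (t : T) : 0 <= \prod_(b | b != a) g b (Z b t).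
  by apply: prodr_ge0 => b _.
have K0 : 0 <= \prod_(b | b != a) \int[gauss]_x g b x.
  by apply: prodr_ge0 => b _; apply: Rintegral_ge0.
transitivity (\int[P]_t (g a (Z a t) * \prod_(b | b != a) g b (Z b t))%:E)%E.
  by apply: eq_integral => t _; rewrite -updD1 updE.
(* The other factors form the weight. The identity to be checked on indicators is the induction
   hypothesis for the family with [g a] replaced by an indicator. *)
rewrite (@ge0_integral_weighted _ _ _ _ _ gauss P (Z a) _
  (\prod_(b | b != a) \int[gauss]_x g b x))//.
- rewrite [in RHS](bigD1 a)//= [in RHS]mulrC EFinM [in RHS]fineK//.
  by apply: integrable_fin_num => //; exact: ig.
- exact: mZ.
- by apply: measurable_prod_family => b; exact: int_meas.
- move=> B mB.
  transitivity (\int[P]_t (\prod_b upd g a \1_B b (Z b t))%:E)%E.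
    by apply: eq_integral => t _; rewrite updD1.
  rewrite IH.
  + rewrite (prod_upd (fun f => \int[gauss]_x f x)) EFinM muleC.
    by rewrite Rintegral_gauss_indic.
  + apply: (upd_ind (fun f => gauss.-integrable setT (EFin \o f))) => //.
    exact: gauss_int_indic.
  + by apply: (upd_ind (fun f => forall x, 0 <= f x)).
  + move=> b bs; rewrite /upd; case: eqP => [_|/eqP ba]; first by exists B.
    by apply: gs; rewrite inE negb_or ba.
- exact: int_meas.
Qed.

Lemma indep_ge0 (g : I -> R -> R) :
  (forall a, gauss.-integrable [set: R] (EFin \o g a)) ->
  (forall a x, 0 <= g a x) ->
  (\int[P]_t (\prod_a g a (Z a t))%:E = (\prod_a \int[gauss]_x g a x)%:E)%E.
Proof.
by move=> ig g0; apply: (@indep_ge0_seq (enum I)) => // a; rewrite mem_enum.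
Qed.

(** The absolute value of a product is the product of the absolute values, whose expectation is a
    finite number by the nonnegative case. *)
Lemma integrable_prod_indep (g : I -> R -> R) :
  (forall a, gauss.-integrable [set: R] (EFin \o g a)) ->
  P.-integrable [set: T] (EFin \o (fun t => \prod_a g a (Z a t))).
Proof.
move=> ig; apply/integrableP; split.
  by apply/measurable_EFinP/measurable_prod_family => a; exact: int_meas.
under eq_integral do rewrite /= normr_prod.
rewrite (indep_ge0 (fun a x => `|g a x|)) ?ltry// => a.
have := integrable_norm (ig a); exact.
Qed.

(** The list [s] holds the indices whose factor may change sign. Each step splits one such factor
    into its positive and negative parts, and both sides are additive in that factor. *)
Lemma indep_seq (s : seq I) (g : I -> R -> R) :
  (forall a, gauss.-integrable [set: R] (EFin \o g a)) ->
  (forall a, a \notin s -> forall x, 0 <= g a x) ->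
  \int[P]_t (\prod_a g a (Z a t)) = \prod_a \int[gauss]_x g a x.
Proof.
elim: s g => [|a s IH] g ig gs.
  by rewrite /Rintegral indep_ge0// => a; exact: gs.
have igp : gauss.-integrable [set: R] (EFin \o (g a)^\+) by exact: integrable_funrpos.
have ign : gauss.-integrable [set: R] (EFin \o (g a)^\-) by exact: integrable_funrneg.
have ipn f : gauss.-integrable [set: R] (EFin \o f) ->
   P.-integrable setT (EFin \o (fun t => \prod_b upd g a f b (Z b t))).
  move=> iF; apply: integrable_prod_indep.
  exact: (upd_ind (fun f => gauss.-integrable setT (EFin \o f))).
have IHf f : gauss.-integrable [set: R] (EFin \o f) -> (forall x, 0 <= f x) ->
   \int[P]_t (\prod_b upd g a f b (Z b t)) = \prod_b \int[gauss]_x upd g a f b x.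
  move=> iF f0; apply: IH.
    exact: (upd_ind (fun f => gauss.-integrable setT (EFin \o f))).
  move=> b bs; rewrite /upd; case: eqP => [_|/eqP ba]//.
  by apply: gs; rewrite inE negb_or ba.
transitivity (\int[P]_t (\prod_b upd g a (g a)^\+ b (Z b t)
    - \prod_b upd g a (g a)^\- b (Z b t))).
  apply: eq_Rintegral => t _.
  rewrite -[in LHS](updE g a) !updD1 -mulrBl; congr (_ * _).
  by rewrite -[in LHS](funrposBneg (g a)).
rewrite RintegralB//; [|exact: ipn..].
rewrite !IHf//.
rewrite !(prod_upd (fun f => \int[gauss]_x f x)) -mulrBl.
rewrite -RintegralB//.
rewrite [RHS](bigD1 a)//=; congr (_ * _).
by apply: eq_Rintegral => x _; rewrite -[in RHS](funrposBneg (g a)).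
Qed.

Lemma Rintegral_prod_indep (g : I -> R -> R) :
  (forall a, gauss.-integrable [set: R] (EFin \o g a)) ->
  \int[P]_t (\prod_a g a (Z a t)) = \prod_a \int[gauss]_x g a x.
Proof.
by move=> ig; apply: (@indep_seq (enum I)) => // a; rewrite mem_enum.
Qed.


End independence.

(** * Polynomials in independent Gaussians and Wick's formula *)

Section gaussian_polynomials.
Context {R : realType} {dT : measure_display} {T : measurableType dT}
  (P : probability T R) {I : finType} (Z : I -> T -> R).
Hypothesis Znorm : forall a, std_normal_rv P (Z a).
Hypothesis Zind : mutually_independent P Z.
Local Notation Ex f := (Rintegral P [set: T] f).
Local Notation integrable_rv f := (P.-integrable [set: T] (EFin \o f)).

Definition monomial (n : I -> nat) (t : T) : R := \prod_a Z a t ^+ n a.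

(* Polynomials in the variables [Z a] with [B a]. *)
Inductive polyrv (B : pred I) : (T -> R) -> Prop :=
| polyrv_monomial c n : (forall a, ~~ B a -> n a = 0%N) ->
    polyrv B (fun t => c * monomial n t)
| polyrv_add f g : polyrv B f -> polyrv B g -> polyrv B (fun t => f t + g t).

Lemma eq_polyrv B f g : f =1 g -> polyrv B f -> polyrv B g.
Proof. by move=> /funext ->. Qed.

Lemma monomialM n m t :
  monomial n t * monomial m t = monomial (fun a => n a + m a)%N t.
Proof.
by rewrite /monomial -big_split; apply: eq_bigr => a _; rewrite exprD.
Qed.

Lemma polyrv_mul B f g :
  polyrv B f -> polyrv B g -> polyrv B (fun t => f t * g t).
Proof.
move=> pf; elim: pf g => {f} [c n Bn|f1 f2 _ IH1 _ IH2] g pg.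
  elim: pg => {g} [c' m Bm|g1 g2 _ IH1 _ IH2].
    apply: eq_polyrv (@polyrv_monomial B (c * c') (fun a => n a + m a)%N _).
      by move=> t; rewrite -monomialM mulrACA.
    by move=> a Ba; rewrite Bn// Bm.
  apply: eq_polyrv (polyrv_add B _ _ IH1 IH2) => t.
  by rewrite mulrDr.
apply: eq_polyrv (polyrv_add B _ _ (IH1 _ pg) (IH2 _ pg)) => t.
by rewrite mulrDl.
Qed.

Lemma polyrv_cst B c : polyrv B (fun=> c).
Proof.
apply: eq_polyrv (@polyrv_monomial B c (fun=> 0%N) _) => // t.
by rewrite /monomial big1 ?mulr1.
Qed.

Lemma polyrv_expvar (B : pred I) a k : B a -> polyrv B (fun t => Z a t ^+ k).
Proof.
move=> Ba.
apply: eq_polyrv (@polyrv_monomial B 1 (fun b => if b == a then k else 0%N) _).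
  move=> t; rewrite mul1r /monomial (bigD1 a)//= eqxx big1 ?mulr1//.
  by move=> b /negPf ->.
by move=> b; case: eqP => [->|//]; rewrite Ba.
Qed.

Lemma polyrv_var (B : pred I) a : B a -> polyrv B (Z a).
Proof. by move=> /(@polyrv_expvar _ _ 1); exact: eq_polyrv. Qed.

Lemma polyrv_sum B (J : Type) (s : seq J) (Q : pred J) (f : J -> T -> R) :
  (forall j, Q j -> polyrv B (f j)) ->
  polyrv B (fun t => \sum_(j <- s | Q j) f j t).
Proof.
move=> pf; elim: s => [|j s IH].
  by apply: eq_polyrv (polyrv_cst B 0) => t; rewrite big_nil.
case: (boolP (Q j)) => Qj.
  by apply: eq_polyrv (polyrv_add B _ _ (pf _ Qj) IH) => t; rewrite big_cons Qj.
by apply: eq_polyrv IH => t; rewrite big_cons (negPf Qj).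
Qed.

Lemma polyrv_subT B f : polyrv B f -> polyrv predT f.
Proof.
elim=> {f} [c n _|f g _ pf _ pg]; first exact: polyrv_monomial.
exact: polyrv_add.
Qed.

Lemma integrable_monomial n : integrable_rv (monomial n).
Proof.
apply: (integrable_prod_indep P Z Znorm Zind (fun a x => x ^+ n a)) => a.
exact: integrable_gauss_pow.
Qed.

Lemma Ex_monomial n : Ex (monomial n) = \prod_a gauss_moment (n a).
Proof.
apply: (Rintegral_prod_indep P Z Znorm Zind (fun a x => x ^+ n a)) => a.
exact: integrable_gauss_pow.
Qed.

Lemma integrable_polyrv B f : polyrv B f -> integrable_rv f.
Proof.
elim=> {f} [c n _|f g _ If _ Ig]; last first.
  by apply: eq_integrable (integrableD measurableT If Ig).
apply: eq_integrable (integrableZl measurableT c (integrable_monomial n)) => //.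
Qed.

Lemma ExD B f g : polyrv B f -> polyrv B g ->
  Ex (fun t => f t + g t) = Ex f + Ex g.
Proof.
move=> /integrable_polyrv pf /integrable_polyrv pg; exact: RintegralD.
Qed.

Lemma ExZ B c f : polyrv B f -> Ex (fun t => c * f t) = c * Ex f.
Proof. by move=> /integrable_polyrv pf; exact: RintegralZl. Qed.

Lemma Ex_sum B (J : Type) (s : seq J) (Q : pred J) (f : J -> T -> R) :
  (forall j, Q j -> polyrv B (f j)) ->
  Ex (fun t => \sum_(j <- s | Q j) f j t) = \sum_(j <- s | Q j) Ex (f j).
Proof.
move=> pf; elim: s => [|j s IH].
  rewrite big_nil; under eq_Rintegral do rewrite big_nil.
  by rewrite Rintegral_cst// mul0r.
rewrite big_cons; case: ifP => Qj.
  under eq_Rintegral do rewrite big_cons Qj.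
  rewrite (@ExD B) ?IH//; [exact: pf|exact: polyrv_sum].
by under eq_Rintegral do rewrite big_cons Qj.
Qed.

(** Bilinearity reduces this to two monomials. At every index at least one of the two exponents is
    0, so the product of moments splits, the zeroth moment being 1. *)
Lemma ExM_indep (B C : pred I) f g : (forall a, B a -> ~~ C a) ->
  polyrv B f -> polyrv C g -> Ex (fun t => f t * g t) = Ex f * Ex g.
Proof.
move=> BC pf; elim: pf g => {f} [c n Bn|f1 f2 pf1 IH1 pf2 IH2] g pg; last first.
  under eq_Rintegral do rewrite mulrDl.
  have pfg h : polyrv B h -> polyrv predT (fun t => h t * g t).
    by move=> ph; apply: polyrv_mul; [exact: polyrv_subT ph|exact: polyrv_subT pg].
  by rewrite (ExD predT _ _ (pfg _ pf1) (pfg _ pf2)) IH1// IH2// (ExD B)// mulrDl.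
elim: pg => {g} [c' m Cm|g1 g2 pg1 IH1 pg2 IH2]; last first.
  under eq_Rintegral do rewrite mulrDr.
  have pfg h : polyrv C h -> polyrv predT (fun t => c * monomial n t * h t).
    by move=> ph; apply: polyrv_mul; [exact: polyrv_monomial|exact: polyrv_subT ph].
  by rewrite (ExD predT _ _ (pfg _ pg1) (pfg _ pg2)) IH1 IH2 (ExD C)// mulrDr.
under eq_Rintegral do rewrite mulrACA monomialM.
rewrite !RintegralZl//; try exact: integrable_monomial.
rewrite mulrACA; congr (_ * _); rewrite !Ex_monomial -big_split.
apply: eq_bigr => a _ /=; case: (boolP (B a)) => Ba.
  by rewrite Cm ?BC// addn0 gauss_moment0 mulr1.
by rewrite Bn// add0n gauss_moment0 mul1r.
Qed.

Lemma Ex_expvar a k : Ex (fun t => Z a t ^+ k) = gauss_moment k.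
Proof.
transitivity (Ex (monomial (fun b => if b == a then k else 0%N))).
  apply: eq_Rintegral => t _; rewrite /monomial (bigD1 a)//= eqxx big1 ?mulr1//.
  by move=> b /negPf ->.
rewrite Ex_monomial (bigD1 a)//= eqxx big1 ?mulr1// => b /negPf ->.
exact: gauss_moment0.
Qed.

(** Peels all powers of one variable off an expectation; the Wick formulas follow by applying it to
    the first index. *)
Lemma Ex_expvarM a k f : polyrv (predC1 a) f ->
  Ex (fun t => Z a t ^+ k * f t) = gauss_moment k * Ex f.
Proof.
move=> pf; rewrite (@ExM_indep (pred1 a) (predC1 a)) ?Ex_expvar//.
  by move=> b /=; rewrite negbK.
by apply: polyrv_expvar => /=.
Qed.

Lemma wick2 a b : Ex (fun t => Z a t * Z b t) = (a == b)%:R.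
Proof.
case: eqVneq => [<-|ab].
  under eq_Rintegral do rewrite -expr2.
  by rewrite Ex_expvar (gauss_moment_even_rec 0) gauss_moment0 mulr1.
under eq_Rintegral do rewrite -[Z a _]expr1.
rewrite Ex_expvarM; last by apply: polyrv_var; rewrite /= eq_sym.
by rewrite gauss_moment_odd// mul0r.
Qed.

(** The cases record which of [b], [c], [e] equal [a], and thus the power of [Z a]. Powers 1 and 3
    give 0, power 2 leaves a product of two variables for [wick2], and power 4 gives 3, one for each
    of the three pairings. *)
Lemma wick4 a b c e :
  Ex (fun t => Z a t * (Z b t * (Z c t * Z e t))) =
  (a == b)%:R * (c == e)%:R + (a == c)%:R * (b == e)%:R
    + (a == e)%:R * (b == c)%:R.
Proof.
have red k F (g : T -> R) : (forall t, g t = Z a t ^+ k * F t) ->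
    polyrv (predC1 a) F -> Ex g = gauss_moment k * Ex F.
  by move=> /funext -> ; exact: Ex_expvarM.
have pv x : a != x -> polyrv (predC1 a) (Z x).
  by move=> ax; apply: polyrv_var; rewrite /= eq_sym.
have m1 : gauss_moment 1 = 0 :> R by rewrite gauss_moment_odd.
have m3 : gauss_moment 3 = 0 :> R by rewrite gauss_moment_odd.
have m2 : gauss_moment 2 = 1 :> R.
  by rewrite (gauss_moment_even_rec 0) gauss_moment0 mulr1.
have m4 : gauss_moment 4 = 3 :> R.
  by rewrite (gauss_moment_even_rec 1) m2 mulr1.
have [<-|ab] := eqVneq a b; have [<-|ac] := eqVneq a c;
  have [<-|ae] := eqVneq a e.
- rewrite -[LHS]/(Ex (fun t => Z a t ^+ 4)) Ex_expvar m4.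
  by rewrite -!natrM -!natrD.
- rewrite (red 3%N (Z e)); [|by move=> t; ring|exact: pv].
  by rewrite m3 !(mulr0n, mul0r, mulr0, addr0).
- rewrite (red 3%N (Z c)); [|by move=> t; ring|exact: pv].
  by rewrite m3 (eq_sym c) (negPf ac) !(mulr0n, mul0r, mulr0, addr0).
- rewrite (red 2%N (fun t => Z c t * Z e t)) ?m2 ?wick2.
  + by rewrite !(mulr0n, mulr1n, mul0r, addr0).
  + by move=> t; ring.
  + by apply: polyrv_mul; exact: pv.
- rewrite (red 3%N (Z b)); [|by move=> t; ring|exact: pv].
  by rewrite m3 (eq_sym b) (negPf ab) !(mulr0n, mul0r, mulr0, addr0).
- rewrite (red 2%N (fun t => Z b t * Z e t)) ?m2 ?wick2.
  + by rewrite !(mulr0n, mulr1n, mul0r, add0r, addr0).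
  + by move=> t; ring.
  + by apply: polyrv_mul; exact: pv.
- rewrite (red 2%N (fun t => Z b t * Z c t)) ?m2 ?wick2.
  + by rewrite !(mulr0n, mulr1n, mul0r, add0r).
  + by move=> t; ring.
  + by apply: polyrv_mul; exact: pv.
- rewrite (red 1%N (fun t => Z b t * (Z c t * Z e t))) ?m1.
  + by rewrite !(mulr0n, mul0r, addr0).
  + by move=> t; ring.
  + by apply: polyrv_mul; [exact: pv|apply: polyrv_mul; exact: pv].
Qed.

Definition linform (u : I -> R) (t : T) : R := \sum_a u a * Z a t.
Definition dot (u v : I -> R) : R := \sum_a u a * v a.

Lemma polyrv_linform (B : pred I) u :
  (forall a, ~~ B a -> u a = 0) -> polyrv B (linform u).
Proof.
move=> Bu; apply: polyrv_sum => a _; case: (boolP (B a)) => [Ba|/Bu ->].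
  by apply: polyrv_mul; [exact: polyrv_cst|exact: polyrv_var].
by apply: eq_polyrv (polyrv_cst B 0) => t; rewrite mul0r.
Qed.

Lemma Ex_linformM u f : polyrv predT f ->
  Ex (fun t => linform u t * f t) = \sum_a u a * Ex (fun t => Z a t * f t).
Proof.
move=> pf; under eq_Rintegral do rewrite mulr_suml.
have pZf a : polyrv predT (fun t => Z a t * f t).
  by apply: polyrv_mul => //; exact: polyrv_var.
rewrite (@Ex_sum predT); last first.
  move=> a _; apply: eq_polyrv (polyrv_mul predT _ _ (polyrv_cst predT (u a)) (pZf a)).
  by move=> t; rewrite mulrA.
apply: eq_bigr => a _; under eq_Rintegral do rewrite -mulrA.
by rewrite (@ExZ predT).
Qed.

Lemma sum_delta (a : I) (u : I -> R) : \sum_b u b * (a == b)%:R = u a.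
Proof.
rewrite (bigD1 a)//= eqxx mulr1 big1 ?addr0// => b ba.
by rewrite eq_sym (negPf ba) mulr0.
Qed.

Lemma Ex_linform2 u v : Ex (fun t => linform u t * linform v t) = dot u v.
Proof.
rewrite Ex_linformM; last exact: polyrv_linform.
apply: eq_bigr => a _; congr (_ * _).
under eq_Rintegral do rewrite mulrC.
rewrite Ex_linformM; last exact: polyrv_var.
rewrite -[RHS](sum_delta a v); apply: eq_bigr => b _.
by rewrite wick2 eq_sym.
Qed.

(** Both sides are linear in each form, so expanding the four forms one at a time reduces the claim
    to [wick4]. *)
Lemma Ex_linform4 u1 u2 u3 u4 :
  Ex (fun t => linform u1 t * (linform u2 t * (linform u3 t * linform u4 t))) =
  dot u1 u2 * dot u3 u4 + dot u1 u3 * dot u2 u4 + dot u1 u4 * dot u2 u3.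
Proof.
have pl u : polyrv predT (linform u) by exact: polyrv_linform.
have pz a : polyrv predT (Z a) by exact: polyrv_var.
have pm f g : polyrv predT f -> polyrv predT g -> polyrv predT (fun t => f t * g t).
  exact: polyrv_mul.
transitivity (\sum_a u1 a * (\sum_b u2 b * (\sum_c u3 c * (\sum_e u4 e *
   Ex (fun t => Z a t * (Z b t * (Z c t * Z e t))))))).
  have red u g F : (forall t, g t = linform u t * F t) -> polyrv predT F ->
      Ex g = \sum_a u a * Ex (fun t => Z a t * F t).
    by move=> /funext ->; exact: Ex_linformM.
  rewrite Ex_linformM; last by do !apply: (pm) => //.
  apply: eq_bigr => a _; congr (_ * _).
  rewrite (red u2 _ (fun t => Z a t * (linform u3 t * linform u4 t))).
  - apply: eq_bigr => b _; congr (_ * _).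
    rewrite (red u3 _ (fun t => Z a t * (Z b t * linform u4 t))).
    + apply: eq_bigr => c _; congr (_ * _).
      rewrite (red u4 _ (fun t => Z a t * (Z b t * Z c t))).
      * apply: eq_bigr => e _; congr (_ * _).
        by apply: eq_Rintegral => t _; ring.
      * by move=> t; ring.
      * by do !apply: (pm) => //.
    + by move=> t; ring.
    + by do !apply: (pm) => //.
  - by move=> t; ring.
  - by do !apply: (pm) => //.
(* The sums are evaluated from the innermost outwards: a Kronecker delta in the summation index
   selects one coefficient, and the remaining term assembles a [dot]. *)
have ein a b c : \sum_e u4 e * Ex (fun t => Z a t * (Z b t * (Z c t * Z e t))) =
    (a == b)%:R * u4 c + (a == c)%:R * u4 b + u4 a * (b == c)%:R.
  under eq_bigr do rewrite wick4 !mulrDr.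
  rewrite !big_split/=; congr (_ + _ + _).
  - rewrite -(sum_delta c u4) mulr_sumr; by apply: eq_bigr => e _; rewrite mulrCA.
  - rewrite -(sum_delta b u4) mulr_sumr; by apply: eq_bigr => e _; rewrite mulrCA.
  - rewrite -(sum_delta a u4) mulr_suml; by apply: eq_bigr => e _; rewrite mulrA.
under eq_bigr do under eq_bigr do under eq_bigr do rewrite ein.
have cin a b : \sum_c u3 c *
    ((a == b)%:R * u4 c + (a == c)%:R * u4 b + u4 a * (b == c)%:R)
   = (a == b)%:R * dot u3 u4 + u3 a * u4 b + u4 a * u3 b.
  under eq_bigr do rewrite !mulrDr.
  rewrite !big_split/=; congr (_ + _ + _).
  - by rewrite mulr_sumr; apply: eq_bigr => c _; rewrite mulrCA.
  - rewrite -(sum_delta a u3) mulr_suml; by apply: eq_bigr => e _; rewrite mulrA.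
  - rewrite -(sum_delta b u3) mulr_sumr; by apply: eq_bigr => e _; rewrite mulrCA.
under eq_bigr do under eq_bigr do rewrite cin.
have bin a : \sum_b u2 b * ((a == b)%:R * dot u3 u4 + u3 a * u4 b + u4 a * u3 b)
   = u2 a * dot u3 u4 + u3 a * dot u2 u4 + u4 a * dot u2 u3.
  under eq_bigr do rewrite !mulrDr.
  rewrite !big_split/=; congr (_ + _ + _).
  - rewrite -(sum_delta a u2) mulr_suml; by apply: eq_bigr => e _; rewrite mulrA.
  - by rewrite mulr_sumr; apply: eq_bigr => c _; rewrite mulrCA.
  - by rewrite mulr_sumr; apply: eq_bigr => c _; rewrite mulrCA.
under eq_bigr do rewrite bin !mulrDr !mulrA.
by rewrite !big_split/= !mulr_suml.
Qed.

End gaussian_polynomials.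

(** * Attention model *)

Section prediction.
Context {R : realType}.

(** Only the label row survives [WPV] and only the covariate rows survive [WKQ]. The zero label of
    the query removes both the residual term and the query's own contribution to the attention sum,
    and the factors [c] and [c^-1] cancel. *)
Lemma fk_block (d Nn M k : nat) (lam : 'I_d -> R) (Q : 'M[R]_d) (c : R)
    (X : 'M[R]_(d, M)) (x : 'cV[R]_d) (y : 'rV[R]_M) : c != 0 ->
  @fk R d Nn M k lam Q c (block_mx X x y 0) =
  \sum_i vk Nn k lam i * (Q^T *m x) i 0 * (M%:R^-1 * \sum_j y 0 j * (Q^T *m X) i j).
Proof.
move=> c0; rewrite /fk.
rewrite tr_block_mx /WKQ /WPV !mulmx_block scale_block_mx mulmx_block.
rewrite add_block_mx block_mxEdr.
rewrite trmx0 !(mul0mx, mulmx0, addr0, add0r) mul_scalar_mx -scalemxAl.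
rewrite -!scalemxAr -!scalemxAl -!scalemxAr !scalerA.
have -> : c^-1 * (M%:R^-1 * c) = M%:R^-1 by rewrite mulrCA mulVf ?mulr1.
rewrite -!mulmxA.
(* Grouping [Q^T] with [X] and with [x] puts both in the eigenbasis, where [Vk] acts
   coordinatewise. *)
have -> : y *m (X^T *m (Q *m (Vk Nn k lam *m (Q^T *m x)))) =
  (y *m (Q^T *m X)^T) *m (Vk Nn k lam *m (Q^T *m x)).
  by rewrite trmx_mul trmxK !mulmxA.
rewrite mxE mul_diag_mx mxE mulr_sumr; apply: eq_bigr => i _.
rewrite !mxE.
have -> : \sum_j y ord0 j * (Q^T *m X)^T j i = \sum_j y 0 j * (Q^T *m X) i j.
  by apply: eq_bigr => j _; rewrite mxE.
by ring.
Qed.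
End prediction.

(** * Coordinates and labels as linear forms in the standard normals, and their covariances *)

Section noise_forms.
Context {R : realType} (d M : nat) (C : 'M[R]_d) (sigma : R) (s : 'cV[R]_d).
Context (lam : 'I_d -> R).
Hypothesis CCT : C *m C^T = diag_mx (\row_i lam i).

(** With [C = Q^T *m A], the vectors [xform], [qform] and [yform] hold the coefficients of the
    eigenbasis coordinates of [x_j] and [x_q] and of the label [y_j]. As [w = Q *m s], the label
    involves [z_j] through [C^T *m s]. *)
Definition xform (j : 'I_M) (i : 'I_d) (a : noise_idx d M) : R :=
  match a with inl (inl (j', l)) => C i l * (j' == j)%:R | _ => 0 end.

Definition qform (i : 'I_d) (a : noise_idx d M) : R :=
  match a with inl (inr l) => C i l | _ => 0 end.

Definition yform (j : 'I_M) (a : noise_idx d M) : R :=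
  match a with
  | inl (inl (j', l)) => (C^T *m s) l 0 * (j' == j)%:R
  | inl (inr _) => 0
  | inr j' => sigma * (j' == j)%:R
  end.

Lemma sum_noise (f : noise_idx d M -> R) :
  \sum_a f a = \sum_j \sum_l f (inl (inl (j, l))) +
    \sum_l f (inl (inr l)) + \sum_j f (inr j).
Proof.
rewrite big_sumType/= big_sumType/=; congr (_ + _ + _).
by rewrite pair_bigA; apply: eq_bigr => -[].
Qed.

Lemma sum_pair_delta (J : finType) (a b : R) (j j' : J) :
  \sum_k (a * (k == j)%:R) * (b * (k == j')%:R) = a * b * (j == j')%:R.
Proof.
rewrite (bigD1 j)//= eqxx mulr1 big1 ?addr0 ?mulrA// => k /negPf ->.
by rewrite mulr0 mul0r.
Qed.

Lemma dot_qform i i' : dot (qform i) (qform i') = (i == i')%:R * lam i.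
Proof.
rewrite /dot sum_noise /= big1 ?add0r; last first.
  by move=> j _; rewrite big1// => l _; rewrite mul0r.
rewrite addrC big1 ?add0r; last by move=> j _; rewrite mul0r.
have := congr1 (fun B : 'M[R]_d => B i i') CCT; rewrite !mxE mulrC mulr_natr => <-.
by apply: eq_bigr => l _; rewrite mxE.
Qed.

Lemma dot_xform j j' i : dot (xform j i) (xform j' i) = (j == j')%:R * lam i.
Proof.
rewrite /dot sum_noise/= [X in (_ + X) + _]big1 ?addr0; last first.
  by move=> l _; rewrite mul0r.
rewrite [X in _ + X]big1 ?addr0; last by move=> l _; rewrite mul0r.
rewrite exchange_big/=; under eq_bigr do rewrite sum_pair_delta.
rewrite -mulr_suml mulrC; congr (_ * _).
have := congr1 (fun B : 'M[R]_d => B i i) CCT; rewrite !mxE eqxx mulr1n => <-.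
by apply: eq_bigr => l _; rewrite mxE.
Qed.

(** For [j = j'] this covariance is the [i]-th entry of [C *m C^T *m s]. It vanishes with [s i 0],
    so labels are uncorrelated with the coordinates that the task does not use. *)
Lemma dot_yform_xform j j' i :
  dot (yform j) (xform j' i) = (j == j')%:R * (lam i * s i 0).
Proof.
rewrite /dot sum_noise/= [X in (_ + X) + _]big1 ?addr0; last first.
  by move=> l _; rewrite mul0r.
rewrite [X in _ + X]big1 ?addr0; last by move=> l _; rewrite mulr0.
rewrite exchange_big/=; under eq_bigr do rewrite sum_pair_delta.
rewrite -mulr_suml mulrC; congr (_ * _).
transitivity ((C *m C^T *m s) i 0).
  by rewrite -mulmxA [RHS]mxE; apply: eq_bigr => l _; rewrite mulrC.
by rewrite CCT mul_diag_mx !mxE.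
Qed.

(** The signal contributes the squared norm of [C^T *m s], which is the [D]-norm of [s] because
    [C *m C^T = D]; the noise contributes [sigma ^+ 2]. *)
Lemma dot_yform j j' : dot (yform j) (yform j') =
  (j == j')%:R * ((s^T *m diag_mx (\row_i lam i) *m s) 0 0 + sigma ^+ 2).
Proof.
rewrite /dot sum_noise/= [X in (_ + X) + _]big1 ?addr0; last first.
  by move=> l _; rewrite mul0r.
rewrite exchange_big/=; under eq_bigr do rewrite sum_pair_delta.
rewrite sum_pair_delta -mulr_suml -mulrDl mulrC -expr2; congr (_ * (_ + _)).
transitivity (((C^T *m s)^T *m (C^T *m s)) 0 0).
  by rewrite [RHS]mxE; apply: eq_bigr => l _; rewrite [in RHS]mxE.
by rewrite trmx_mul trmxK -CCT !mulmxA.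
Qed.

Section linforms.
Context {dT : measure_display} {T : measurableType dT}
  (Z : noise_idx d M -> T -> R) (Q A : 'M[R]_d) (t : T).
Hypothesis CE : C = Q^T *m A.

Lemma linform_xform j i :
  linform Z (xform j i) t = (Q^T *m xj A Z j t) i 0.
Proof.
rewrite /xj mulmxA -CE /linform sum_noise/= [X in (_ + X) + _]big1 ?addr0; last first.
  by move=> l _; rewrite mul0r.
rewrite [X in _ + X]big1 ?addr0; last by move=> l _; rewrite mul0r.
rewrite (bigD1 j)//= [X in _ + X]big1 ?addr0; last first.
  by move=> k /negPf ->; rewrite big1// => l _; rewrite mulr0 mul0r.
by rewrite mxE; apply: eq_bigr => l _; rewrite mxE eqxx mulr1.
Qed.

Lemma linform_qform i : linform Z (qform i) t = (Q^T *m xq A Z t) i 0.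
Proof.
rewrite /xq mulmxA -CE /linform sum_noise /= big1 ?add0r; last first.
  by move=> k _; rewrite big1// => l _; rewrite mul0r.
rewrite [X in _ + X]big1 ?addr0; last by move=> l _; rewrite mul0r.
by rewrite mxE; apply: eq_bigr => l _; rewrite mxE.
Qed.

Lemma linform_yform j : linform Z (yform j) t =
  dotv (Q *m s) (xj A Z j t) + eps sigma Z j t.
Proof.
rewrite /dotv /eps /xj /linform sum_noise/= [X in (_ + X) + _]big1 ?addr0; last first.
  by move=> l _; rewrite mul0r.
congr (_ + _); last first.
  rewrite (bigD1 j)//= eqxx mulr1 big1 ?addr0// => k /negPf ->.
  by rewrite mulr0 mul0r.
rewrite (bigD1 j)//= [X in _ + X]big1 ?addr0; last first.
  by move=> k /negPf ->; rewrite big1// => l _; rewrite mulr0 mul0r.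
rewrite mulmxA (_ : _ *m A = (C^T *m s)^T); last first.
  by rewrite CE !trmx_mul !trmxK mulmxA.
rewrite [RHS]mxE; apply: eq_bigr => l _.
by rewrite eqxx mulr1 [(C^T *m s)^T 0 l]mxE [(\col_(_ < d) _) _ _]mxE.
Qed.

End linforms.
End noise_forms.

(** * The loss in the eigenbasis *)

Section risk.
Context {R : realType} (d M : nat) (Q A : 'M[R]_d) (sigma : R) (s : 'cV[R]_d).
Context (lam : 'I_d -> R) {dT : measure_display} {T : measurableType dT}
  (P : probability T R) (Z : noise_idx d M -> T -> R).
Hypothesis QTQ : Q^T *m Q = 1%:M.
Hypothesis AAT : A *m A^T = Q *m diag_mx (\row_i lam i) *m Q^T.
Hypothesis Znorm : forall a, std_normal_rv P (Z a).
Hypothesis Zind : mutually_independent P Z.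
Local Notation Ex f := (Rintegral P [set: T] f).
Local Notation C := (Q^T *m A).
Local Notation Lx j i := (linform Z (xform d M C j i)).
Local Notation Lq i := (linform Z (qform d M C i)).
Local Notation Ly j := (linform Z (yform d M C sigma s j)).

Lemma whitening_gram : C *m C^T = diag_mx (\row_i lam i).
Proof.
rewrite trmx_mul trmxK mulmxA -(mulmxA _ A) AAT !mulmxA QTQ mul1mx.
by rewrite -mulmxA QTQ mulmx1.
Qed.

Definition corr (i : 'I_d) (t : T) : R := M%:R^-1 * \sum_j Ly j t * Lx j i t.

Lemma fk_Ehat Nn k c t : c != 0 ->
  @fk R d Nn M k lam Q c (Ehat A sigma (Q *m s) Z t) =
  \sum_i vk Nn k lam i * Lq i t * corr i t.
Proof.
move=> c0; rewrite /Ehat fk_block//; apply: eq_bigr => i _.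
rewrite (linform_qform d M C Z Q A t erefl); congr (_ * (_ * _)).
apply: eq_bigr => j _.
rewrite (linform_xform d M C Z Q A t erefl) (linform_yform d M C sigma s Z Q A t erefl).
rewrite mxE; congr (_ * _); rewrite [LHS]mxE [RHS]mxE; apply: eq_bigr => l _.
by rewrite [X in _ * X]mxE.
Qed.

Lemma target_qform t : dotv (Q *m s) (xq A Z t) = \sum_i s i 0 * Lq i t.
Proof.
rewrite /dotv trmx_mul -mulmxA mxE; apply: eq_bigr => i _.
by rewrite (linform_qform d M C Z Q A t erefl) mxE.
Qed.

(** Splitting the variables into those of [x_q] and all others lets [ExM_indep] separate the query
    from the prompt. *)
Let query : pred (noise_idx d M) :=
  fun a => if a is inl (inr _) then true else false.

Let prompt : pred (noise_idx d M) := predC query.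

Lemma polyrv_qform i : polyrv Z query (Lq i).
Proof. by apply: polyrv_linform => -[[[]|]|]. Qed.

Lemma polyrv_corr i : polyrv Z prompt (corr i).
Proof.
apply: polyrv_mul; first exact: polyrv_cst.
apply: polyrv_sum => j _; apply: polyrv_mul.
  by apply: polyrv_linform => -[[[]|]|].
by apply: polyrv_linform => -[[[]|]|].
Qed.

(** After expanding the square, each term factors by independence; distinct query coordinates are
    uncorrelated, so only the diagonal remains. *)
Lemma Ex_query_square (g : 'I_d -> T -> R) :
  (forall i, polyrv Z prompt (g i)) ->
  Ex (fun t => (\sum_i Lq i t * g i t) ^+ 2) =
  \sum_i lam i * Ex (fun t => g i t ^+ 2).
Proof.
move=> pg.
have pgg i i' : polyrv Z prompt (fun t => g i t * g i' t) by exact: polyrv_mul.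
have pqq i i' : polyrv Z query (fun t => Lq i t * Lq i' t).
  by apply: polyrv_mul; exact: polyrv_qform.
have pt i i' : polyrv Z predT (fun t => (Lq i t * Lq i' t) * (g i t * g i' t)).
  by apply: polyrv_mul;
    [exact: polyrv_subT Z _ _ (pqq _ _)|exact: polyrv_subT Z _ _ (pgg _ _)].
transitivity (Ex (fun t => \sum_i \sum_i' (Lq i t * Lq i' t) * (g i t * g i' t))).
  apply: eq_Rintegral => t _; rewrite expr2 mulr_suml; apply: eq_bigr => i _.
  by rewrite mulr_sumr; apply: eq_bigr => i' _; rewrite mulrACA.
rewrite (Ex_sum P Z Znorm Zind predT); last by move=> i _; apply: polyrv_sum.
apply: eq_bigr => i _; rewrite (Ex_sum P Z Znorm Zind predT)//.
transitivity (\sum_i' (i == i')%:R * lam i * Ex (fun t => g i t * g i' t)).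
  apply: eq_bigr => i' _; rewrite (ExM_indep P Z Znorm Zind query prompt)//.
    by rewrite Ex_linform2// (dot_qform d M C lam whitening_gram).
  by move=> a; rewrite /prompt /= negbK.
rewrite (bigD1 i)//= eqxx mul1r big1 ?addr0// => i' /negPf.
by rewrite eq_sym => ->; rewrite !mul0r.
Qed.

(** The square is a double sum over examples scaled by [M ^ -2]. Only its [M] diagonal terms are
    nonzero, and they are equal, which leaves a single factor [1 / M]. *)
Lemma Ex_corr_square i : (0 < M)%N -> s i 0 = 0 ->
  Ex (fun t => corr i t ^+ 2) =
  M%:R^-1 * ((s^T *m diag_mx (\row_i lam i) *m s) 0 0 + sigma ^+ 2) * lam i.
Proof.
move=> M0 si0.
have pl u : polyrv Z predT (linform Z u) by exact: polyrv_linform.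
have pt j j' : polyrv Z predT
    (fun t => Ly j t * (Lx j i t * (Ly j' t * Lx j' i t))).
  by do !(apply: polyrv_mul => //).
transitivity (Ex (fun t => M%:R^-2 *
    \sum_j \sum_j' Ly j t * (Lx j i t * (Ly j' t * Lx j' i t)))).
  apply: eq_Rintegral => t _; rewrite /corr exprMn exprVn; congr (_ * _).
  rewrite expr2 mulr_suml; apply: eq_bigr => j _.
  by rewrite mulr_sumr; apply: eq_bigr => j' _; rewrite mulrA.
have ps j : polyrv Z predT
    (fun t => \sum_j' Ly j t * (Lx j i t * (Ly j' t * Lx j' i t))).
  exact: polyrv_sum.
rewrite (ExZ P Z Znorm Zind predT); last exact: polyrv_sum.
rewrite (Ex_sum P Z Znorm Zind predT)//.
set V := _ + sigma ^+ 2.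
transitivity (M%:R^-2 * \sum_(j < M) (V * lam i)).
  congr (_ * _); apply: eq_bigr => j _.
  rewrite (Ex_sum P Z Znorm Zind predT)//.
  (* Of the three Wick pairings, the two that pair a label with a coordinate vanish since
     [s i 0 = 0]. Pairing label with label and coordinate with coordinate survives for [j = j']. *)
  transitivity (\sum_(j' < M) (j == j')%:R * (V * lam i)).
    apply: eq_bigr => j' _; rewrite Ex_linform4//.
    rewrite (dot_xform d M C lam whitening_gram).
    rewrite !(dot_yform_xform d M C sigma s lam whitening_gram) si0.
    rewrite (dot_yform d M C sigma s lam whitening_gram) -/V.
    rewrite !(mulr0, mul0r, add0r, addr0).
    by case: (j == j'); rewrite !(mul0r, mul1r).
  rewrite (bigD1 j)//= eqxx mul1r big1 ?addr0// => j' /negPf.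
  by rewrite eq_sym => ->; rewrite !mul0r.
rewrite sumr_const card_ord -mulr_natl.
have Mn0 : M%:R != 0 :> R by rewrite pnatr_eq0 -lt0n.
by field.
Qed.

(** Prediction minus target is linear in the query coordinates, with coefficients [vk * corr - s]
    depending only on the prompt, so [Ex_query_square] applies. *)
Lemma loss_fk Nn k c : c != 0 ->
  loss P (@fk R d Nn M k lam Q c) A sigma (Q *m s) Z =
  (\sum_i lam i * Ex (fun t => (vk Nn k lam i * corr i t - s i 0) ^+ 2))%:E.
Proof.
move=> c0.
have pg i : polyrv Z prompt (fun t => vk Nn k lam i * corr i t - s i 0).
  apply: (polyrv_add Z prompt _ (fun=> - s i 0)); last exact: polyrv_cst.
  by apply: polyrv_mul; [exact: polyrv_cst|exact: polyrv_corr].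
(* The loss is an extended real; identifying it with a real expectation requires finiteness, which
   holds because the integrand is a polynomial in the Gaussians. *)
rewrite -Ex_query_square// /Rintegral fineK; last first.
  apply: integrable_fin_num => //.
  apply: (integrable_polyrv P Z Znorm Zind predT).
  have pU : polyrv Z predT (fun t => \sum_i Lq i t * (vk Nn k lam i * corr i t - s i 0)).
    apply: polyrv_sum => i _; apply: polyrv_mul.
      exact: polyrv_subT Z _ _ (polyrv_qform i).
    exact: polyrv_subT Z _ _ (pg i).
  exact: polyrv_mul.
rewrite /loss; apply: eq_integral => t _; congr (_ ^+ 2)%:E.
rewrite fk_Ehat// target_qform -sumrB; apply: eq_bigr => i _.
by ring.
Qed.

End risk.

(** * Comparison of the losses at ranks [r] and [r'] *)

Theorem theorem4p4 (R : realType) (d Nn M : nat) (sigma : R)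
  (Lambda Q A : 'M[R]_d) (lam : 'I_d -> R) (r r' : nat)
  (c1 c2 : R) (s : 'cV[R]_d)
  (dT : measure_display) (T : measurableType dT) (P : probability T R)
  (Z : noise_idx d M -> T -> R) :
  (1 <= d)%N -> (1 <= Nn)%N -> (1 <= M)%N -> 0 <= sigma ->
  Lambda^T = Lambda ->
  (forall u : 'cV[R]_d, 0 <= (u^T *m Lambda *m u) 0 0) ->
  Q^T *m Q = 1%:M ->
  Lambda = Q *m diag_mx (\row_i lam i) *m Q^T ->
  (forall i j : 'I_d, (i <= j)%N -> lam j <= lam i) ->
  (forall i, 0 <= lam i) ->
  A *m A^T = Lambda ->
  c1 != 0 -> c2 != 0 ->
  (r <= r')%N -> (r' <= d)%N ->
  (forall i : 'I_d, (r <= i)%N -> s i 0 = 0) ->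
  (forall a, std_normal_rv P (Z a)) ->
  mutually_independent P Z ->
  let w := Q *m s in
  let f1 := @fk R d Nn M r lam Q c1 in
  let f2 := @fk R d Nn M r' lam Q c2 in
  (loss P f2 A sigma w Z - loss P f1 A sigma w Z)%E =
  ((M%:R)^-1 * ((s^T *m diag_mx (\row_i lam i) *m s) 0 0 + sigma ^+ 2) *
   \sum_(i < d | (r <= i < r')%N)
     (Nn%:R * lam i / ((Nn.+1)%:R * lam i + \sum_(j < d) lam j)) ^+ 2)%:E.
Proof.
move=> _ _ M0 _ _ _ QTQ LE _ _ AAT c10 c20 rr' _ s0 Znorm Zind w f1 f2.
rewrite LE in AAT.
have lossE k c := loss_fk d M Q A sigma s lam P Z QTQ AAT Znorm Zind Nn k c.
transitivity ((\sum_i lam i * Rintegral P [set: T]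
      (fun t => (vk Nn r' lam i * corr d M Q A sigma s Z i t - s i 0) ^+ 2))%:E -
    (\sum_i lam i * Rintegral P [set: T]
      (fun t => (vk Nn r lam i * corr d M Q A sigma s Z i t - s i 0) ^+ 2))%:E)%E.
  by congr (_ - _)%E; [exact: lossE|exact: lossE].
rewrite -EFinB -sumrB mulr_sumr [in RHS]big_mkcond/=; congr EFin.
apply: eq_bigr => i _; rewrite /vk.
(* Below [r] both models have the same weight, and from [r'] on both weights are 0, so only the
   indices in between contribute. *)
case: (ltnP i r) => [ir|ri] /=.
  by rewrite (leq_trans ir rr') subrr.
case: (ltnP i r') => ir' /=; last by rewrite subrr.
rewrite (s0 i ri).
have pc := polyrv_corr d M Q A sigma s Z i.
set v := _ / _.
have -> : Rintegral P [set: T] (fun t => (v * corr d M Q A sigma s Z i t - 0) ^+ 2) =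
    v ^+ 2 * Rintegral P [set: T] (fun t => corr d M Q A sigma s Z i t ^+ 2).
  under eq_Rintegral do rewrite subr0 exprMn.
  exact: (ExZ P Z Znorm Zind _ _ _ (polyrv_mul Z _ _ _ pc pc)).
rewrite (Ex_corr_square d M Q A sigma s lam P Z QTQ AAT Znorm Zind)// ?s0//.
have -> : Rintegral P [set: T] (fun t => (0 * corr d M Q A sigma s Z i t - 0) ^+ 2) = 0.
  under eq_Rintegral do rewrite mul0r subr0 expr0n.
  by rewrite Rintegral_cst// mul0r.
(* One factor [lam i] comes from the query and one from [Ex_corr_square]. The rewriting only
   permutes factors, so it also covers a zero denominator, where division by 0 makes [v] equal to
   0. *)
have -> : Nn%:R * lam i / (Nn.+1%:R * lam i + \sum_(j < d) lam j) = v * lam i.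
  by rewrite /v mulrAC.
by ring.
Qed.
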